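(* Let $G$ be a topological group and let $M$ be a non-empty topological $G$-median algebra which is minimal. Assume that $M$ is sclocc and that all intervals of $M$ are countable. Then there exist topological $G$-median algebras $M'$ and $C$ such that $M\simeq M'\times C$ (as topological $G$-median algebras, with the diagonal $G$-action on the product), $C$ is a finite cube, and every surjective morphism $M\to C'$, where $C'$ is a $G$-cube, is the composition of the projection map $M\to C$ and a unique morphism $C\to C'$.
   Context: A median algebra is a set $M$ with a ternary operation $m:M^3\to M$ such that for all $x,y,z,u,v\in M$: (1) $m(x,y,z)=m(x,z,y)=m(y,x,z)$; (2) $m(x,x,y)=x$; (3) $m(m(x,y,z),u,v)=m(x,m(y,u,v),m(z,u,v))$. A median map is a map commuting with $m$. The interval $[x,y]$ is $\{z\in M: m(x,y,z)=z\}$. A subset $A$ is convex if $[x,y]\subset A$ for all $x,y\in A$. A topological median algebra is a median algebra with a Hausdorff topology for which $m$ is continuous; it is locally open-convex if every point has a basis of open convex neighborhoods. ''Sclocc'' means second countable, locally open-convex and compact. ''Countable'' includes finite. A cube is a median algebra isomorphic to $\{0,1\}^n$ (coordinatewise majority median) for some cardinal $n$, its dimension; a finite cube is a finite-dimensional one (dimension $0$, a point, is allowed). For a topological group $G$, a topological $G$-median algebra is a topological median algebra $M$ with an action of $G$ by automorphisms such that the action map $G\times M\to M$ is continuous. A $G$-cube is a topological $G$-median algebra which is a cube. A morphism of topological $G$-median algebras is a $G$-equivariant continuous median map. A topological $G$-median algebra $M$ is minimal if it contains no non-empty, proper, closed, $G$-invariant median subalgebra. *)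

(* Defs.v *)
From HB Require Import structures.
From mathcomp Require Import all_boot all_order all_algebra all_classical topology.

Set Implicit Arguments.
Unset Strict Implicit.
Unset Printing Implicit Defensive.

Local Open Scope classical_set_scope.

HB.mixin Record isTopologicalGroup G & Group G & Topological G := {
  mulg_continuous : continuous (fun p : G * G => (p.1 * p.2)%g);
  invg_continuous : continuous (fun g : G => (g^-1)%g);
}.

(* No separation axiom is imposed on the group. *)
#[short(type="topologicalGroupType")]
HB.structure Definition TopologicalGroup :=
  {G of Group G & Topological G & isTopologicalGroup G}.

HB.mixin Record isMedianAlgebra (M : Type) := {
  med : M -> M -> M -> M;
  medCr : forall x y z, med x y z = med x z y;
  medCl : forall x y z, med x y z = med y x z;
  medxx : forall x y, med x x y = x;
  med_distr : forall x y z u v,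
    med (med x y z) u v = med x (med y u v) (med z u v);
}.

#[short(type="medianType")]
HB.structure Definition MedianAlgebra := {M of isMedianAlgebra M}.

HB.mixin Record isTopologicalMedian M & Topological M & MedianAlgebra M := {
  topmed_hausdorff : hausdorff_space M;
  med_continuous :
    continuous (fun p : M * M * M => med p.1.1 p.1.2 p.2);
}.

#[short(type="topologicalMedianType")]
HB.structure Definition TopologicalMedian :=
  {M of Topological M & MedianAlgebra M & isTopologicalMedian M}.

(* Left actions; each g acts by a homeomorphism because of gact_continuous and
   the group laws, hence by an automorphism because of gact_med. *)
HB.mixin Record isGMedian (G : topologicalGroupType) M
    & TopologicalMedian M := {
  gact : G -> M -> M;
  gact1 : forall x, gact 1%g x = x;
  gactM : forall g h x, gact (g * h)%g x = gact g (gact h x);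
  gact_med : forall g x y z,
    gact g (med x y z) = med (gact g x) (gact g y) (gact g z);
  gact_continuous : continuous (fun p : G * M => gact p.1 p.2);
}.

#[short(type="gMedianType")]
HB.structure Definition GMedian (G : topologicalGroupType) :=
  {M of TopologicalMedian M & isGMedian G M}.

Section Median.
Variable M : medianType.

Definition median_interval (x y : M) : set M := [set z | med x y z = z].

Definition median_convex (A : set M) :=
  forall x y, A x -> A y -> median_interval x y `<=` A.

Definition median_subalgebra (A : set M) :=
  forall x y z, A x -> A y -> A z -> A (med x y z).

End Median.

Definition median_map (M N : medianType) (f : M -> N) :=
  forall x y z, f (med x y z) = med (f x) (f y) (f z).

Section Cubes.

Definition majority (a b c : bool) := [|| a && b, b && c | a && c].

Let majorityCr a b c : majority a b c = majority a c b.
Proof. by case: a; case: b; case: c. Qed.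

Let majorityCl a b c : majority a b c = majority b a c.
Proof. by case: a; case: b; case: c. Qed.

Let majorityxx a b : majority a a b = a.
Proof. by case: a; case: b. Qed.

Let majority_distr a b c u v :
  majority (majority a b c) u v =
  majority a (majority b u v) (majority c u v).
Proof. by case: a; case: b; case: c; case: u; case: v. Qed.

HB.instance Definition _ := isMedianAlgebra.Build bool
  majorityCr majorityCl majorityxx majority_distr.

Variables (I : Type) (M : medianType).

Let fmed (f g h : I -> M) : I -> M := fun i => med (f i) (g i) (h i).

Let fmedCr f g h : fmed f g h = fmed f h g.
Proof. by apply/funext => i; exact: medCr. Qed.

Let fmedCl f g h : fmed f g h = fmed g f h.
Proof. by apply/funext => i; exact: medCl. Qed.

Let fmedxx f g : fmed f f g = f.
Proof. by apply/funext => i; exact: medxx. Qed.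

Let fmed_distr f g h u v :
  fmed (fmed f g h) u v = fmed f (fmed g u v) (fmed h u v).
Proof. by apply/funext => i; exact: med_distr. Qed.

HB.instance Definition _ := isMedianAlgebra.Build (I -> M)
  fmedCr fmedCl fmedxx fmed_distr.

End Cubes.

(* The isomorphism is one of bare median algebras: no condition relates a
   topology on M to the product topology of {0,1}^I. *)
Definition cube_on (I : Type) (M : medianType) :=
  exists f : M -> (I -> bool), bijective f /\ median_map f.

Definition is_cube (M : medianType) := exists I : Type, cube_on I M.

Definition is_finite_cube (M : medianType) := exists n : nat, cube_on 'I_n M.

Definition locally_open_convex (M : topologicalMedianType) :=
  forall (x : M) (V : set M), nbhs x V ->
    exists U : set M, [/\ open U, U x, median_convex U & U `<=` V].

Definition sclocc (M : topologicalMedianType) :=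
  [/\ @second_countable M, locally_open_convex M & compact [set: M]].

Section GMedianTheory.
Variable G : topologicalGroupType.

Definition g_invariant (M : gMedianType G) (A : set M) :=
  forall (g : G) x, A x -> A (gact g x).

Definition g_minimal (M : gMedianType G) :=
  ~ exists A : set M,
      [/\ A !=set0, A <> setT, closed A, g_invariant A & median_subalgebra A].

Definition g_morphism (M N : gMedianType G) (f : M -> N) :=
  [/\ continuous f, median_map f & forall (g : G) x, f (gact g x) = gact g (f x)].

Definition g_isomorphism (M N : gMedianType G) (f : M -> N) :=
  g_morphism f /\
  exists f' : N -> M, [/\ g_morphism f', cancel f f' & cancel f' f].

End GMedianTheory.

Section ProductMedian.
Variables M N : medianType.

Let pmed (p q r : M * N) := (med p.1 q.1 r.1, med p.2 q.2 r.2).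

Let pmedCr p q r : pmed p q r = pmed p r q.
Proof. by congr pair; exact: medCr. Qed.

Let pmedCl p q r : pmed p q r = pmed q p r.
Proof. by congr pair; exact: medCl. Qed.

Let pmedxx p q : pmed p p q = p.
Proof. by case: p => x y; congr pair; exact: medxx. Qed.

Let pmed_distr p q r u v :
  pmed (pmed p q r) u v = pmed p (pmed q u v) (pmed r u v).
Proof. by congr pair; exact: med_distr. Qed.

HB.instance Definition _ := isMedianAlgebra.Build (M * N)%type
  pmedCr pmedCl pmedxx pmed_distr.

End ProductMedian.

Lemma continuous_pair (S T U : topologicalType) (f : S -> T) (g : S -> U) :
  continuous f -> continuous g -> continuous (fun s => (f s, g s)).
Proof. by move=> cf cg s; apply: cvg_pair; [exact: cf|exact: cg]. Qed.

Lemma continuous_compose (S T U : topologicalType) (f : S -> T) (g : T -> U) :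
  continuous f -> continuous g -> continuous (g \o f).
Proof. by move=> cf cg s; apply: continuous_comp; [exact: cf|exact: cg]. Qed.

Lemma continuous_fst (S T : topologicalType) : continuous (@fst S T).
Proof. by move=> ?; exact: cvg_fst. Qed.

Lemma continuous_snd (S T : topologicalType) : continuous (@snd S T).
Proof. by move=> ?; exact: cvg_snd. Qed.

Section ProductTopologicalMedian.
Variables M N : topologicalMedianType.

Let prod_hausdorff : hausdorff_space (M * N)%type.
Proof.
move=> [x1 x2] [y1 y2] clxy; congr pair.
  apply: topmed_hausdorff => A B Ax By.
  have [[a b] [/= ? ?]] : (fst @^-1` A `&` fst @^-1` B : set (M * N)) !=set0.
    by apply: clxy; exact: continuous_fst.
  by exists a.
apply: topmed_hausdorff => A B Ax By.
have [[a b] [/= ? ?]] : (snd @^-1` A `&` snd @^-1` B : set (M * N)) !=set0.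
  by apply: clxy; exact: continuous_snd.
by exists b.
Qed.

Let prod_med_continuous :
  continuous (fun p : (M * N) * (M * N) * (M * N) => med p.1.1 p.1.2 p.2).
Proof.
pose T := ((M * N) * (M * N) * (M * N))%type.
have c11 : continuous (fun p : T => p.1.1).
  by apply: continuous_compose; exact: continuous_fst.
have c12 : continuous (fun p : T => p.1.2).
  by apply: continuous_compose; [exact: continuous_fst|exact: continuous_snd].
have c2 : continuous (fun p : T => p.2) by exact: continuous_snd.
apply: continuous_pair.
  apply: (@continuous_compose T (M * M * M)%type M
    (fun p => (p.1.1.1, p.1.2.1, p.2.1)) (fun q => med q.1.1 q.1.2 q.2)).
    apply: continuous_pair; first apply: continuous_pair.
    - exact: continuous_compose c11 (@continuous_fst _ _).
    - exact: continuous_compose c12 (@continuous_fst _ _).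
    - exact: continuous_compose c2 (@continuous_fst _ _).
  exact: med_continuous.
apply: (@continuous_compose T (N * N * N)%type N
  (fun p => (p.1.1.2, p.1.2.2, p.2.2)) (fun q => med q.1.1 q.1.2 q.2)).
  apply: continuous_pair; first apply: continuous_pair.
  - exact: continuous_compose c11 (@continuous_snd _ _).
  - exact: continuous_compose c12 (@continuous_snd _ _).
  - exact: continuous_compose c2 (@continuous_snd _ _).
exact: med_continuous.
Qed.

HB.instance Definition _ := isTopologicalMedian.Build (M * N)%type
  prod_hausdorff prod_med_continuous.

End ProductTopologicalMedian.

Section ProductGMedian.
Variables (G : topologicalGroupType) (M N : gMedianType G).

Let pact (g : G) (p : M * N) := (gact g p.1, gact g p.2).

Let pact1 p : pact 1%g p = p.
Proof. by case: p => x y; rewrite /pact !gact1. Qed.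

Let pactM g h p : pact (g * h)%g p = pact g (pact h p).
Proof. by rewrite /pact !gactM. Qed.

Let pact_med g p q r :
  pact g (med p q r) = med (pact g p) (pact g q) (pact g r).
Proof. by congr pair; exact: gact_med. Qed.

Let pact_continuous : continuous (fun p : G * (M * N) => pact p.1 p.2).
Proof.
apply: continuous_pair.
  apply: (@continuous_compose _ (G * M)%type _
    (fun p => (p.1, p.2.1)) (fun q => gact q.1 q.2)); last first.
    exact: gact_continuous.
  apply: continuous_pair; first exact: continuous_fst.
  by apply: continuous_compose; [exact: continuous_snd|exact: continuous_fst].
apply: (@continuous_compose _ (G * N)%type _
  (fun p => (p.1, p.2.2)) (fun q => gact q.1 q.2)); last first.
  exact: gact_continuous.
apply: continuous_pair; first exact: continuous_fst.
by apply: continuous_compose; exact: continuous_snd.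
Qed.

HB.instance Definition _ := isGMedian.Build G (M * N)%type
  pact1 pactM pact_med pact_continuous.

End ProductGMedian.

(* Main.v *)
Require Import Defs.
From HB Require Import structures.
From mathcomp Require Import all_boot all_order all_algebra all_classical topology.

Set Implicit Arguments.
Unset Strict Implicit.
Unset Printing Implicit Defensive.

Local Open Scope classical_set_scope.

(* Call a clopen halfspace of [M] splitting when every point has a neighbour
   across its wall, i.e. a point from which only that wall separates it.
   A surjection from [M] onto a [G]-cube pulls the walls of the cube back to a
   [G]-invariant family of walls, and the points having a neighbour across each
   of them form a closed [G]-invariant subalgebra.  This set is non-empty: it
   contains the gate, in the fibre of a vertex, of any point lying over the
   opposite vertex.  By minimality it is [M], so every [G]-cube quotient is
   read off from splitting walls.
   Flipping across a splitting wall changes no other splitting wall, so by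
   compactness infinitely many of them would give a Cantor set in an interval;
   hence they are finite in number.  For a base point [a], let [K] be the
   intersection of the splitting halfspaces containing [a], [p] the gate map
   onto [K] and [q] the gate map onto the fibre [p^-1(a)].  The finite cube [C]
   is this fibre, [M'] is [K], and the isomorphism is [(p, q)]. *)

(** * Median algebras *)

Section MedianTheory.
Variable M : medianType.
Implicit Types (x y z q : M) (K : set M).

Lemma medrr x y : med x y y = y.
Proof. by rewrite medCl medCr medxx. Qed.

Lemma medlr x y : med x y x = x.
Proof. by rewrite medCr medxx. Qed.

Lemma med_rot x y z : med x y z = med y z x.
Proof. by rewrite medCl medCr. Qed.

Lemma medA q x y z : med q (med q x y) z = med q x (med q y z).
Proof. by rewrite medCl (medCl q x y) med_distr medxx medCl (medCl y). Qed.

(* [med q x y = x] is the order relation [x <= y] of the semilattice with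
   bottom [q] and meet [med q]. *)
Lemma med_trans q x y z : med q x y = x -> med q y z = y -> med q x z = x.
Proof. by move=> <- yz; rewrite medA yz. Qed.

Lemma med_mono1 q x x' y z :
  med q x x' = x -> med q (med x y z) (med x' y z) = med x y z.
Proof. by move=> xx'; rewrite -med_distr xx'. Qed.

Lemma med_mono q x x' y y' z z' :
  med q x x' = x -> med q y y' = y -> med q z z' = z ->
  med q (med x y z) (med x' y' z') = med x y z.
Proof.
move=> xx' yy' zz'; apply: med_trans (med_mono1 _ _ xx') _.
rewrite (med_rot x') (med_rot x'); apply: med_trans (med_mono1 _ _ yy') _.
by rewrite (med_rot y') (med_rot y'); exact: med_mono1.
Qed.

Lemma med_in_itv x y z : median_interval x y (med x y z).
Proof. by rewrite /median_interval /= -medA medrr. Qed.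

(** The nearest-point projection onto [K], kept as a relation because existence is only obtained
    later, from compactness. *)
Definition gate K x z := K z /\ forall q, K q -> median_interval x q z.

Lemma gate_unique K x z z' : gate K x z -> gate K x z' -> z = z'.
Proof. by move=> [Kz zP] [Kz' z'P]; rewrite -(zP _ Kz') medCr (z'P _ Kz). Qed.

Lemma gate_id K x : K x -> gate K x x.
Proof. by move=> Kx; split=> // q _; exact: medlr. Qed.

(** Lying in [[x, q]] means being below [x] in the order with bottom [q], and the median is monotone
    for that order. *)
Lemma gate_med K x y z x' y' z' : median_convex K ->
  gate K x x' -> gate K y y' -> gate K z z' ->
  gate K (med x y z) (med x' y' z').
Proof.
move=> cK [Kx' x'P] [Ky' y'P] [Kz' z'P]; split.
  exact: cK Kx' Ky' _ (med_in_itv _ _ _).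
move=> q Kq; rewrite /median_interval /= med_rot; apply: med_mono.
- by rewrite -med_rot; exact: x'P.
- by rewrite -med_rot; exact: y'P.
- by rewrite -med_rot; exact: z'P.
Qed.

End MedianTheory.

(** * Adjacent points and the wall between them *)

Section Crossing.
Variable M : medianType.
Implicit Types (x y z w : M) (k l : M -> bool).

(* [x] and [y] are adjacent and the halfspace [k] (a map to the two-point cube)
   is the one separating them. *)
Definition crosses k x y :=
  k y = ~~ k x /\ forall z, med x y z = if k z == k x then x else y.

Lemma crosses_sym k x y : crosses k x y -> crosses k y x.
Proof.
move=> [kyx xyP]; split=> [|z]; first by rewrite kyx negbK.
by rewrite medCl xyP kyx; case: (k z); case: (k x).
Qed.

Lemma crosses_addb k l b x y :
  crosses k x y -> (forall z, l z = k z (+) b) -> crosses l x y.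
Proof.
move=> [kyx xyP] lE; split=> [|z]; first by rewrite !lE kyx addNb.
by rewrite xyP !lE; case: b {lE}; case: (k z); case: (k x).
Qed.

Lemma crosses_near k x y z : crosses k x y -> k z = k x -> med x y z = x.
Proof. by move=> [_ ->] ->; rewrite eqxx. Qed.

Lemma crosses_far k x y z : crosses k x y -> k z = ~~ k x -> med x y z = y.
Proof. by move=> [_ ->] ->; case: (k x). Qed.

Lemma crosses_unique k x y y' : crosses k x y -> crosses k x y' -> y = y'.
Proof.
move=> xy xy'; rewrite -(crosses_far xy (proj1 xy')) medCr.
by rewrite (crosses_far xy' (proj1 xy)).
Qed.

(** [med x y z] is [x] or [y] according to [k z], while [l] takes both values on [x] and [y], so its
    value at this median is [l z]. Thus an edge is crossed by one wall only. *)
Lemma crosses_separate k l x y : median_map l -> crosses k x y -> l x != l y ->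
  forall z, l z = k z (+) (l x (+) k x).
Proof.
move=> lmed xy lxy z; have := lmed x y z; rewrite (proj2 xy).
by move: lxy; case: (k z); case: (k x); case: (l x); case: (l y); case: (l z).
Qed.

(** The median [u] of the [xi] lies across the wall from [x3], so [y3] is between [x3] and [u];
    distributivity then carries [y3] to [u]. *)
Lemma crosses_replace k x1 x2 x3 y3 :
  median_map k -> crosses k x3 y3 -> k x1 = k x2 -> k x1 != k x3 ->
  med x1 x2 y3 = med x1 x2 x3.
Proof.
move=> kmed xy k12 k13.
have ku : k (med x1 x2 x3) = ~~ k x3.
  by rewrite kmed -k12 medxx; case: (k x1) k13; case: (k x3).
have := med_distr y3 x3 (med x1 x2 x3) x1 x2.
rewrite (medCl y3 x3) (crosses_far xy ku) (med_rot y3 x1 x2) => ->.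
by rewrite (med_rot x3) (med_rot _ x1 x2) med_in_itv medrr.
Qed.

(** In the order with bottom [w], a point on the side of [w] is below its neighbour. At least two of
    the [xi] are on that side; a third one across the wall is traded for [yi] by [crosses_replace],
    and [med_mono] applies. *)
Lemma crosses_med_le k x1 x2 x3 y1 y2 y3 w : median_map k ->
  crosses k x1 y1 -> crosses k x2 y2 -> crosses k x3 y3 ->
  k w = k (med x1 x2 x3) ->
  med w (med x1 x2 x3) (med y1 y2 y3) = med x1 x2 x3.
Proof.
move=> kmed c1 c2 c3 kw.
have le x y : crosses k x y -> k x = k w -> med w x y = x.
  by move=> c kx; rewrite med_rot (crosses_near c).
suff [x1' [x2' [x3' [-> m1 m2 m3]]]] : exists x1' x2' x3',
    [/\ med x1 x2 x3 = med x1' x2' x3', med w x1' y1 = x1',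
        med w x2' y2 = x2' & med w x3' y3 = x3'].
  exact: med_mono.
have [k12|k12] := eqVneq (k x1) (k x2).
  have kx1 : k x1 = k w by rewrite kw kmed -k12 medxx.
  have [k3|k3] := eqVneq (k x3) (k w).
    by exists x1, x2, x3; split=> //; apply: le => //; rewrite -k12.
  exists x1, x2, y3; split; [|exact: le|by apply: le; rewrite -?k12|exact: medrr].
  by rewrite (crosses_replace kmed c3) // kx1 eq_sym.
have [k3|k3] := eqVneq (k x3) (k x2).
  have kx2 : k x2 = k w by rewrite kw kmed k3 medrr.
  exists y1, x2, x3; split; [|exact: medrr|exact: le|by apply: le; rewrite ?k3].
  by rewrite !(med_rot x1, med_rot y1) (crosses_replace kmed c1) // eq_sym.
have k31 : k x3 = k x1.
  by move: k12 k3; case: (k x1); case: (k x2); case: (k x3).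
have kx1 : k x1 = k w by rewrite kw kmed k31 medlr.
exists x1, y2, x3; split; [|exact: le|exact: medrr|by apply: le; rewrite ?k31].
by rewrite !(medCr x1 _ x3) (crosses_replace kmed c2).
Qed.

Lemma crosses_med k x1 x2 x3 y1 y2 y3 : median_map k ->
  crosses k x1 y1 -> crosses k x2 y2 -> crosses k x3 y3 ->
  crosses k (med x1 x2 x3) (med y1 y2 y3).
Proof.
move=> kmed c1 c2 c3.
have ky : k (med y1 y2 y3) = ~~ k (med x1 x2 x3).
  rewrite !kmed (proj1 c1) (proj1 c2) (proj1 c3).
  by case: (k x1); case: (k x2); case: (k x3).
split=> // z; rewrite -[LHS]med_rot; have [kz|kz] := eqVneq.
  by rewrite (crosses_med_le kmed c1 c2 c3).
(* On the other side of the wall, the two ends of every edge exchange roles. *)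
rewrite medCr (@crosses_med_le k) //; try exact: crosses_sym.
by rewrite ky; case: (k z) kz; case: (k _).
Qed.

End Crossing.

(** * Compact median algebras *)

Section Topology.

Lemma closed_eq_fun (S T : topologicalType) (f g : S -> T) :
  hausdorff_space T -> continuous f -> continuous g ->
  closed [set x | f x = g x].
Proof.
move=> hT cf cg x clx; apply: hT => A B fA gB.
have [y [/= fgy [Afy Bgy]]] := clx _
  (@filterI _ (nbhs x) _ (f @^-1` A) (g @^-1` B) (cf x A fA) (cg x B gB)).
by exists (f y); split=> //; rewrite fgy.
Qed.

Lemma closed_graph_continuous (S T : topologicalType) (f : S -> T) :
  hausdorff_space T -> compact [set: T] ->
  closed [set p : S * T | f p.1 = p.2] -> continuous f.
Proof.
move=> hT cT clf x.
have clusterP y : cluster (f @ x) y -> f x = y.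
  move=> cly; apply: (clf (x, y)) => B [[A1 A2] [/= xA1 yA2] sB].
  have [|_ [[z A1z <-] A2z]] := cly (f @` A1) A2 _ yA2.
    by apply: filterS xA1 => z; exists z.
  by exists (z, f z); split=> //; exact: sB.
apply: (compact_cluster_set1 hT cT) => //; try exact: filterT.
apply/seteqP; split=> y /=; first by move/clusterP.
move=> ->; have [z [_ zc]] := cT (f @ x) _ filterT.
by rewrite (clusterP _ zc).
Qed.

Lemma compact_directed (T : topologicalType) (I : Type) (D : set I)
    (B : I -> set T) :
  compact [set: T] -> D !=set0 ->
  (forall i j, D i -> D j -> exists2 h, D h & B h `<=` B i `&` B j) ->
  (forall i, D i -> closed (B i)) -> (forall i, D i -> B i !=set0) ->
  exists x, forall i, D i -> B i x.
Proof.
move=> cT D0 dirB clB B0.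
have FB := filter_from_proper (filter_from_filter D0 dirB) B0.
have [x [_ xB]] := cT _ FB filterT.
exists x => i Di; apply: (clB i Di) => A xA.
by apply: xB => //; exists i.
Qed.

Lemma continuous_boolP (S : topologicalType) (k : S -> bool) :
  continuous k <-> forall b, closed [set x | k x = b].
Proof.
split=> [ck b|clk x A kxA].
  rewrite (_ : mkset _ = k @^-1` [set b]) //.
  by move/continuous_closedP: ck; apply; exact: discrete_closed.
have : nbhs x (~` [set y | k y = ~~ k x]).
  apply: open_nbhs_nbhs; split; first exact/closed_openC.
  by move=> /=; case: (k x).
apply: filterS => y /= kyx; rewrite (_ : k y = k x); first exact: nbhs_singleton.
by case: (k y) kyx; case: (k x) => // /(_ erefl).
Qed.

End Topology.

Section CompactMedian.
Variable M : topologicalMedianType.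
Implicit Types (x y z : M) (K : set M) (k : M -> bool).

Lemma continuous_med (S : topologicalType) (f g h : S -> M) :
  continuous f -> continuous g -> continuous h ->
  continuous (fun s => med (f s) (g s) (h s)).
Proof.
move=> cf cg ch.
apply: (@continuous_compose S (M * M * M)%type M
  (fun s => (f s, g s, h s)) (fun q => med q.1.1 q.1.2 q.2)).
  by do 2![apply: continuous_pair => //].
exact: med_continuous.
Qed.

Lemma continuous_id (S : topologicalType) : continuous (fun x : S => x).
Proof. by move=> x A. Qed.

Lemma continuous_const (S T : topologicalType) (a : T) :
  continuous (fun _ : S => a).
Proof. by move=> x; exact: cvg_cst. Qed.

Lemma closed_itv x y : closed (median_interval x y).
Proof.
apply: closed_eq_fun; first exact: topmed_hausdorff.
  by apply: continuous_med; [exact: continuous_const..|exact: continuous_id].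
exact: continuous_id.
Qed.

Hypothesis M_compact : compact [set: M].

(** The sets [K] meet [[x, q]], for [q] in [K], are directed: the one for [med x q1 q2] lies in
    those for [q1] and [q2]. Compactness gives a common point. *)
Lemma gate_exists K x : closed K -> median_convex K -> K !=set0 ->
  exists z, gate K x z.
Proof.
move=> clK cK K0.
have [|||z zP] := @compact_directed M M K
  (fun q => K `&` median_interval x q) M_compact K0.
- move=> q1 q2 Kq1 Kq2; exists (med x q1 q2).
    by apply: cK Kq1 Kq2 _ _; rewrite med_rot; exact: med_in_itv.
  move=> z [Kz]; rewrite /median_interval /= medCr => zle.
  split; split=> //=; rewrite medCr; apply: med_trans zle _.
    by rewrite medA medCr medA medrr medCr.
  by rewrite medA medrr.
- by move=> q Kq; apply: closedI => //; exact: closed_itv.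
- by move=> q Kq; exists q; split=> //; exact: medrr.
- have [q Kq] := K0; exists z; split; first exact: (zP q Kq).1.
  by move=> r Kr; exact: (zP r Kr).2.
Qed.

(** The conditions defining a gate are closed, so the graph of [p] is closed, and [M] is compact. *)
Lemma gate_continuous K (p : M -> M) : closed K ->
  (forall x, gate K x (p x)) -> continuous p.
Proof.
move=> clK pP; apply: closed_graph_continuous => //.
  exact: topmed_hausdorff.
rewrite (_ : mkset _ = [set xz | K xz.2] `&`
  \bigcap_(q in K) [set xz | med xz.1 q xz.2 = xz.2]).
  apply: closedI.
    exact: (continuous_closedP _).1 (@continuous_snd M M) _ clK.
  apply: closed_bigI => q _; apply: closed_eq_fun.
  - exact: topmed_hausdorff.
  - apply: continuous_med; first exact: continuous_fst.
      exact: continuous_const.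
    exact: continuous_snd.
  - exact: continuous_snd.
apply/seteqP; split=> -[x z] /=.
  by move<-; split; [exact: (pP x).1|exact: (pP x).2].
by move=> xz; apply: gate_unique (pP x) _.
Qed.

Lemma gate_median_map K (p : M -> M) : median_convex K ->
  (forall x, gate K x (p x)) -> median_map p.
Proof.
move=> cK pP x y z; apply: gate_unique (pP _) _.
exact: gate_med (pP x) (pP y) (pP z).
Qed.

(** The edges crossed by [k] form a closed, hence compact, subset of the square, and this set is its
    projection. *)
Lemma closed_crossed k : continuous k -> closed [set x | exists y, crosses k x y].
Proof.
move=> ck.
pose E := [set xy : M * M | crosses k xy.1 xy.2].
suff clE : closed E.
  rewrite (_ : mkset _ = fst @` E).
    apply: compact_closed; first exact: topmed_hausdorff.
    apply: continuous_compact.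
      by apply: continuous_subspaceT; exact: continuous_fst.
    exact: (subclosed_compact clE (compact_setX M_compact M_compact)).
  apply/seteqP; split=> [x [y xy]|x [[x' y] xy <-]]; last by exists y.
  by exists (x, y).
have clk1 b : closed [set xy : M * M | k xy.1 = b].
  apply: (continuous_boolP (k \o fst)).1.
  by exact: (continuous_compose (@continuous_fst M M) ck).
have clk2 b : closed [set xy : M * M | k xy.2 = b].
  apply: (continuous_boolP (k \o snd)).1.
  by exact: (continuous_compose (@continuous_snd M M) ck).
have clmed (z : M) (f : M * M -> M) : continuous f ->
    closed [set xy : M * M | med xy.1 xy.2 z = f xy].
  move=> cf; apply: closed_eq_fun => //; first exact: topmed_hausdorff.
  apply: continuous_med; first exact: continuous_fst.
    exact: continuous_snd.
  exact: continuous_const.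
(* The first intersection says that [k] separates the two points; the second writes the two cases of
   the median as unions of closed conditions. *)
rewrite (_ : E =
  (\bigcap_(b in setT) ([set xy | k xy.1 = ~~ b] `|` [set xy | k xy.2 = ~~ b]))
  `&` \bigcap_(z in setT)
    (([set xy | k xy.1 = ~~ k z] `|` [set xy | med xy.1 xy.2 z = xy.1]) `&`
     ([set xy | k xy.1 = k z] `|` [set xy | med xy.1 xy.2 z = xy.2]))).
  apply: closedI.
    by apply: closed_bigI => b _; apply: closedU.
  apply: closed_bigI => z _; apply: closedI; apply: closedU => //;
    apply: clmed; [exact: continuous_fst|exact: continuous_snd].
apply/seteqP; split=> -[x y] /=.
  move=> [kyx xyP]; split=> [b _|z _] /=.
    by rewrite kyx; case: b; case: (k x); [right|left|left|right].
  rewrite xyP; split; case: (k x); case: (k z) => /=; by [left|right].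
move=> [kP zP]; split=> [|z].
  have [] := kP (k x) I => /=; last by [].
  by case: (k x).
have [/= [kx|xz] [kx'|yz]] := zP z I.
- by move: kx; rewrite kx'; case: (k z).
- by rewrite yz kx; case: (k z).
- by rewrite xz kx' eqxx.
- by case: ifP.
Qed.

End CompactMedian.

(** * Cube quotients *)

Section Cubes.
Variables (I : Type) (C : topologicalMedianType) (phi : C -> I -> bool).
Hypotheses (phi_bij : bijective phi) (phi_med : median_map phi).

Lemma coord_med i : median_map (fun c => phi c i).
Proof. by move=> x y z; rewrite phi_med. Qed.

Lemma coord_crosses i c : exists d, crosses (fun c => phi c i) c d.
Proof.
have [psi phiK psiK] := phi_bij.
exists (psi (fun j => phi c j (+) `[< j = i >])).
split=> [|z]; first by rewrite psiK asboolT // addbT.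
apply: (can_inj phiK); rewrite phi_med (fun_if phi) psiK.
apply/funext => j; rewrite (fun_if (fun h => h j)).
rewrite [LHS]/(majority _ _ _) /majority.
have [->|ji] := pselect (j = i); first rewrite asboolT //.
  by case: (phi c i); case: (phi z i).
by rewrite asboolF // addbF; case: ifP => _; case: (phi c j); case: (phi z j).
Qed.

(* The facets of the cube are intervals. *)
Lemma coord_continuous i : continuous (fun c => phi c i).
Proof.
have [psi phiK psiK] := phi_bij.
apply/continuous_boolP => b.
rewrite (_ : mkset _ = median_interval (psi (fun _ => b))
  (psi (fun j => if `[< j = i >] then b else ~~ b))); first exact: closed_itv.
apply/seteqP; split=> c; rewrite /median_interval /=.
  move=> cb; apply: (can_inj phiK); rewrite phi_med !psiK; apply/funext => j.
  rewrite [LHS]/(majority _ _ _) /majority.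
  have [->|ji] := pselect (j = i); first rewrite asboolT // cb.
    by case: (b).
  by rewrite asboolF //; case: (b); case: (phi c j).
move=> /(congr1 (phi ^~ i)) /=; rewrite phi_med !psiK.
rewrite [X in X = _ -> _]/(majority _ _ _) asboolT //= /majority => <-.
by case: (b); case: (phi c i).
Qed.

End Cubes.

(** * Surjections onto a cube *)

Section CubeMaps.
Variables (M : topologicalMedianType) (I : Type) (F : M -> I -> bool).
Hypotheses (M_compact : compact [set: M]).
Hypotheses (F_med : median_map F) (F_cont : forall i, continuous (fun x => F x i)).
Hypothesis F_surj : forall e, exists x, F x = e.

Lemma fiber_gate x (e : I -> bool) : exists z, gate [set y | F y = e] x z.
Proof.
apply: gate_exists => //.
- rewrite (_ : mkset _ = \bigcap_(i in setT) [set y | F y i = e i]).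
    by apply: closed_bigI => i _; exact: (continuous_boolP _).1.
  apply/seteqP; split=> [y /= Fy i _ /=|y ye]; first by rewrite Fy.
  by apply/funext => i; exact: ye.
- by move=> y z /= Fy Fz w yzw; rewrite -yzw /= F_med Fy Fz medxx.
- exact: F_surj.
Qed.

Lemma med_coord x y z i : F (med x y z) i = majority (F x i) (F y i) (F z i).
Proof. by rewrite F_med. Qed.

Lemma crossed_vertex : exists x, forall i, exists y, crosses (fun x => F x i) x y.
Proof.
have [b Fb] := F_surj (fun _ => true).
have [x [/= Fx xP]] := fiber_gate b (fun _ => false).
exists x => i.
have [y [/= Fy yP]] := fiber_gate x (fun j => `[< j = i >]).
(* [med x b y] lies in the same fibre as [y], so the gate property puts [y] between [x] and [b]. *)
have yb : med b y x = y.
  have q_y : F (med x b y) = fun j => `[< j = i >].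
    apply/funext => j; rewrite med_coord Fx Fb Fy /majority.
    by case: (asbool _).
  have := yP _ q_y; rewrite /median_interval /=.
  by rewrite medA medrr med_rot.
exists y; split=> [|z]; first by rewrite Fx Fy asboolT.
(* If [F z i] holds, [med x y z] is in the fibre of [y], so [y] is between [x] and it; otherwise it
   is in the fibre of [x], so [x] is between [b] and it. *)
rewrite Fx; case Fz : (F z i) => /=.
  rewrite -[LHS](med_in_itv x y z) medCr yP //.
  apply/funext => j; rewrite /= med_coord Fx Fy /majority.
  have [->|ji] := pselect (j = i); last by rewrite asboolF.
  by rewrite Fz asboolT.
have bq : med b (med x y z) x = x.
  apply: xP => /=; apply/funext => j; rewrite med_coord Fx Fy /majority.
  have [->|ji] := pselect (j = i); last by rewrite asboolF.
  by rewrite Fz asboolT.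
have := med_distr y b x (med x y z) x.
rewrite (medCl y b) yb bq medlr medrr => xE.
by rewrite -[RHS]xE -(med_rot x y) med_in_itv.
Qed.

End CubeMaps.

Definition splitting (M : topologicalMedianType) (k : M -> bool) :=
  [/\ continuous k, median_map k & forall x, exists y, crosses k x y].

(** * Action of the group on splitting walls *)

Section GMedianTheory.
Variables (G : topologicalGroupType) (M : gMedianType G).
Implicit Types (g : G) (x y z : M) (k : M -> bool).

Lemma gactK g : cancel (gact g : M -> M) (gact g^-1%g).
Proof. by move=> x; rewrite -gactM mulVg gact1. Qed.

Lemma gactVK g : cancel (gact g^-1%g : M -> M) (gact g).
Proof. by move=> x; rewrite -gactM mulgV gact1. Qed.

Lemma continuous_gact g : continuous (gact g : M -> M).
Proof.
apply: (@continuous_compose M (G * M)%type M (fun x => (g, x))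
  (fun p => gact p.1 p.2)).
  by apply: continuous_pair; [exact: continuous_const|exact: continuous_id].
exact: gact_continuous.
Qed.

Lemma crosses_gact g k x y :
  crosses k (gact g x) (gact g y) <-> crosses (k \o gact g) x y.
Proof.
split=> -[kyx xyP]; split=> // z.
  apply: (can_inj (gactK g)); rewrite gact_med xyP /=.
  by rewrite (fun_if (gact g)).
rewrite -[z](gactVK g) -gact_med xyP /=.
by rewrite (fun_if (gact g)).
Qed.

Lemma splitting_gact g k : splitting k -> splitting (k \o gact g).
Proof.
move=> [ck kmed kP]; split.
- exact: (continuous_compose (@continuous_gact g) ck).
- by move=> x y z; rewrite /= gact_med kmed.
- move=> x; have [y xy] := kP (gact g x).
  by exists (gact g^-1%g y); apply/crosses_gact; rewrite gactVK.
Qed.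

End GMedianTheory.

Section CubeQuotients.
Variables (G : topologicalGroupType) (M C : gMedianType G) (f : M -> C).
Variables (I : Type) (phi : C -> I -> bool).
Hypotheses (M_nonempty : [set: M] !=set0) (M_minimal : g_minimal M).
Hypothesis M_compact : compact [set: M].
Hypotheses (f_morph : g_morphism f) (f_surj : set_surj [set: M] [set: C] f).
Hypotheses (phi_bij : bijective phi) (phi_med : median_map phi).

(* The group permutes the walls of the cube: the image of an edge is an edge,
   and an edge is crossed by just one wall. *)
Lemma coord_gact g i : exists j b, forall c, phi (gact g c) i = phi c j (+) b.
Proof.
have [x0 _] := M_nonempty.
pose c := f x0.
have [d0 cd0] := coord_crosses phi_bij phi_med i (gact g c).
pose d := gact g^-1%g d0.
have cd : crosses ((fun c => phi c i) \o gact g) c d.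
  by apply/crosses_gact; rewrite gactVK.
have [j phij] : exists j, phi c j != phi d j.
  apply: contrapT => /forallNP phiE; have := proj1 cd.
  rewrite (_ : d = c) /=; first by case: (phi _ _).
  apply: (bij_inj phi_bij); apply/funext => j.
  by apply/eqP; rewrite eq_sym; apply: contrapT => /negP; exact: phiE.
have jE := crosses_separate (coord_med phi_med j) cd phij.
exists j, (phi c j (+) phi (gact g c) i) => c'.
by rewrite jE /= -addbA addbb addbF.
Qed.

Lemma cube_map_splitting i : splitting (fun x => phi (f x) i).
Proof.
have [cf fmed fg] := f_morph.
have Fc j : continuous (fun x => phi (f x) j).
  exact: (continuous_compose cf (coord_continuous phi_bij phi_med (i := j))).
have Fm : median_map (phi \o f) by move=> x y z; rewrite /= fmed phi_med.
have Fmi j : median_map (fun x => phi (f x) j).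
  by move=> x y z; rewrite fmed phi_med.
pose N := [set x | forall j, exists y, crosses (fun x => phi (f x) j) x y].
suff NT : N = setT.
  by split=> // x; have : N x by rewrite NT.
apply: contrapT => NnT; apply: M_minimal; exists N; split=> //.
- apply: (crossed_vertex M_compact Fm Fc) => e.
  have [psi phiK psiK] := phi_bij.
  have [x _ fx] := @f_surj (psi e) Logic.I.
  by exists x; rewrite /= fx psiK.
- rewrite (_ : N = \bigcap_(j in setT)
    [set x | exists y, crosses (fun x => phi (f x) j) x y]).
    by apply: closed_bigI => j _; exact: closed_crossed.
  by apply/seteqP; split=> [x Nx j _|x Nx j]; exact: Nx.
(* Pulled back by [g], wall [j] is wall [h] up to complement, so [g] carries a neighbour across [h]
   to one across [j]. *)
- move=> g x Nx j; have [h [b hE]] := coord_gact g j.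
  have [y xy] := Nx h; exists (gact g y); apply/crosses_gact.
  by apply: crosses_addb xy _ => z; rewrite /= fg hE.
- move=> x y z Nx Ny Nz j.
  have [[x' xx'] [y' yy'] [z' zz']] := And3 (Nx j) (Ny j) (Nz j).
  by exists (med x' y' z'); exact: crosses_med.
Qed.

End CubeQuotients.

(** * Splitting walls *)

Section Flips.
Variables (M : topologicalMedianType) (a : M).
Implicit Types (x y z : M) (k l : M -> bool) (s : seq (M -> bool)).

(** The neighbour across [k] is unique when it exists; the default [x] is never returned for
    splitting [k]. *)
Definition flip k x := xget x [set y | crosses k x y].

Lemma flipP k x : splitting k -> crosses k x (flip k x).
Proof. by move=> [_ _ kP]; apply: xgetPex; exact: kP. Qed.

Lemma flipK k : splitting k -> involutive (flip k).
Proof.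
move=> kS x; apply: crosses_unique (flipP _ kS) _.
exact/crosses_sym/flipP.
Qed.

Lemma splitting_negb k : splitting k -> splitting (negb \o k).
Proof.
move=> [/continuous_boolP ck kmed kP]; split.
- apply/continuous_boolP => b; rewrite (_ : mkset _ = [set x | k x = ~~ b]) //.
  by apply/seteqP; split=> x /=; [move=> <-; rewrite negbK|move=> ->; rewrite negbK].
- by move=> x y z; rewrite /= kmed; case: (k x); case: (k y); case: (k z).
- move=> x; have [y xy] := kP x; exists y.
  by apply: (crosses_addb (b := true) xy) => z; rewrite addbT.
Qed.

(** Taking the side that contains [a] selects one halfspace for each splitting wall. *)
Definition base_halfspaces : set (M -> bool) := [set k | splitting k /\ k a].

Lemma base_halfspaces_eq x y :
  (forall k, base_halfspaces k -> k x = k y) ->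
  forall k, splitting k -> k x = k y.
Proof.
move=> xy k kS; have [ka|/negP ka] := boolP (k a); first exact: xy.
have /negb_inj // : ~~ k x = ~~ k y.
apply: (xy (negb \o k)); split; first exact: splitting_negb.
exact/negP.
Qed.

(** If [l] changed along the edge, it would be [k] or its complement, and both contain [a]. *)
Lemma flip_other k l x : base_halfspaces k -> base_halfspaces l -> l <> k ->
  l (flip k x) = l x.
Proof.
move=> [kS ka] [[_ lmed _] la] lk; apply: contrapT => lx.
apply: lk; apply/funext => z.
have lkx : l x != l (flip k x) by apply/eqP => /esym.
have lE := crosses_separate lmed (flipP x kS) lkx.
have := lE a; rewrite (lE z) la ka.
by case: (l x (+) k x) => // _; rewrite addbF.
Qed.

Definition flips s x := foldr flip x s.

Lemma flips_coord s k x : (forall l, l \in s -> base_halfspaces l) -> uniq s ->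
  base_halfspaces k -> k (flips s x) = k x (+) (k \in s).
Proof.
move=> sP + kP; elim: s sP => [|l s IHs] sP /=; first by rewrite addbF.
have {}IHs : uniq s -> k (flips s x) = k x (+) (k \in s).
  by apply: IHs => m ms; apply: sP; rewrite inE ms orbT.
have lP : base_halfspaces l by apply: sP; exact: mem_head.
move=> /andP[ls us]; rewrite inE; have [kl|/eqP kl] := eqVneq k l.
  subst l; have [-> _] := flipP (flips s x) lP.1.
  by rewrite IHs // (negbTE ls) addbF addbT.
by rewrite flip_other //= IHs.
Qed.

Lemma flips_inj s : (forall l, l \in s -> base_halfspaces l) ->
  injective (flips s).
Proof.
elim: s => [|l s IHs] sP x y //= xy.
have /sP[lS _] := mem_head l s.
apply: IHs (can_inj (flipK lS) xy) => k ks.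
by apply: sP; rewrite inE ks orbT.
Qed.

Hypothesis M_compact : compact [set: M].

Lemma independent_halfspaces (h : nat -> M -> bool) (e : nat -> bool) :
  injective h -> (forall n, base_halfspaces (h n)) ->
  exists x, forall n, h n x = e n.
Proof.
move=> h_inj hP.
have [|i j _ _|n _|n _|x xP] := @compact_directed M nat setT
    (fun n => [set x | forall i, (i < n)%N -> h i x = e i]) M_compact.
- by exists 0%N.
- exists (maxn i j) => // x /= xP.
  by split=> m mi; apply: xP; rewrite leq_max mi ?orbT.
- rewrite (_ : mkset _ = \bigcap_(i in [set i | (i < n)%N]) [set x | h i x = e i]) //.
  apply: closed_bigI => i _; apply: (continuous_boolP _).1.
  by have [[]] := hP i.
(* Since [a] lies in every [h i], it suffices to flip those with [e i] false. *)
- exists (flips [seq h i | i <- iota 0 n & ~~ e i] a) => i /= i_n.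
  rewrite flips_coord //.
  + have [_ ->] := hP i; rewrite mem_map // mem_filter mem_iota /= add0n i_n.
    by case: (e i).
  + by move=> _ /mapP[j _ ->].
  + by rewrite map_inj_uniq // filter_uniq // iota_uniq.
- by exists x => n; exact: (xP n.+1).
Qed.

Hypothesis M_intervals : forall x y : M, countable (median_interval x y).

(* Infinitely many splitting walls would embed the Cantor set in an interval. *)
Lemma finite_base_halfspaces : finite_set base_halfspaces.
Proof.
apply: contrapT => /infiniteP /pcard_leP[h].
have h_inj : injective h by move=> i j; apply: 'inj_h; rewrite inE.
have hP n : base_halfspaces (h n) by exact: funS.
have hmed n : median_map (h n) by have [[]] := hP n.
have [x xP] := choice (fun e => independent_halfspaces e h_inj hP).
(* The ends of this interval have opposite coordinates for every [h n], so the median keeps the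
   coordinates of [x e]. *)
pose z e := med (x (fun _ => false)) a (x e).
have hz e n : h n (z e) = e n.
  by rewrite hmed !xP (hP n).2; case: (e n).
have [c c_inj] := countable_injP _ (M_intervals (x (fun _ => false)) a).
have {}c_inj e e' : c (z e) = c (z e') -> e = e'.
  move=> cz; have ze : z e = z e'.
    by apply: c_inj cz; rewrite inE; exact: med_in_itv.
  by apply/funext => n; rewrite -hz ze hz.
(* Cantor's diagonal argument against the injection [e] to [c (z e)]. *)
pose d n := `[< exists2 e, n = c (z e) & ~~ e n >].
have [dd|dd] := boolP (d (c (z d))).
  by have [e /c_inj <-] := asboolW dd; rewrite dd.
have : d (c (z d)) by apply/asboolP; exists d.
by rewrite (negbTE dd).
Qed.

End Flips.

(** * Projections *)

Section Projections.
Variables (M : topologicalMedianType) (a : M).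
Implicit Types (x y z : M) (k : M -> bool) (s : seq (M -> bool)).

(** The set [K] of the overview. *)
Definition base_side : set M := [set x | forall k, splitting k -> k x = k a].

Lemma closed_base_side : closed base_side.
Proof.
rewrite (_ : base_side =
  \bigcap_(k in splitting (M := M)) [set x | k x = k a]) //.
by apply: closed_bigI => k [ck _ _]; exact: (continuous_boolP _).1.
Qed.

Lemma convex_base_side : median_convex base_side.
Proof.
move=> x y Kx Ky z xyz k kS; rewrite -xyz.
by have [_ -> _] := kS; rewrite Kx // Ky // medxx.
Qed.

(** All of [base_side] is on one side of [k]. If [x] is on that side, it is between [y] and [q];
    otherwise [y] is between [x] and [z]. *)
Lemma gate_crosses k x y z : splitting k -> crosses k x y ->
  gate base_side x z -> gate base_side y z.
Proof.
move=> kS xy [Kz xP]; split=> // q Kq; have xqz := xP q Kq.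
have [kx|kx] := eqVneq (k x) (k a).
  have xyq : med x y q = x by apply: crosses_near xy _; rewrite Kq.
  rewrite /median_interval /= med_rot; apply: (@med_trans _ q z x y).
    by rewrite -med_rot.
  by rewrite med_rot.
have xyz : med x y z = y.
  by apply: crosses_far xy _; rewrite Kz //; case: (k x) kx; case: (k a).
rewrite /median_interval /= -[X in med X _ _]xyz (medCl x) med_distr.
by rewrite xqz medlr medrr.
Qed.

Hypothesis finite_base : finite_set (base_halfspaces a).

Variable p : M -> M.
Hypothesis pP : forall x, gate base_side x (p x).

Lemma proj_base : p a = a.
Proof. by apply: gate_unique (pP a) _; apply: gate_id. Qed.

Lemma proj_crosses k x y : splitting k -> crosses k x y -> p x = p y.
Proof.
by move=> kS xy; apply: gate_unique _ (pP y); exact: gate_crosses xy (pP x).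
Qed.

Lemma proj_flips s x : (forall k, k \in s -> base_halfspaces a k) ->
  p (flips s x) = p x.
Proof.
elim: s => //= k s IHs sP; rewrite -IHs => [|l ls].
  have /sP[kS _] := mem_head k s.
  exact/esym/(proj_crosses kS)/flipP.
by apply: sP; rewrite inE ls orbT.
Qed.

Lemma base_halfspaces_enum : exists s : seq (M -> bool),
  uniq s /\ forall k, k \in s <-> base_halfspaces a k.
Proof.
have [s sE] := (finite_seqP _).1 finite_base.
exists (undup s); split=> [|k]; first exact: undup_uniq.
by rewrite sE mem_undup.
Qed.

Lemma proj_surj x (e : (M -> bool) -> bool) :
  exists y, p y = p x /\ forall k, base_halfspaces a k -> k y = e k.
Proof.
have [s [us sP]] := base_halfspaces_enum.
(* Flipping exactly the walls where [x] and [e] disagree leaves the projection unchanged. *)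
pose t := [seq k <- s | k x != e k].
have tP k : k \in t -> base_halfspaces a k.
  by rewrite mem_filter => /andP[_ /sP].
exists (flips t x); split; first exact: proj_flips.
move=> k kP; rewrite (flips_coord _ tP) ?filter_uniq // mem_filter.
by move/sP: kP => ->; case: (k x); case: (e k).
Qed.

(** Flipping every wall that separates the point from [a] lands in [base_side] without changing the
    gate. The list depends only on the coordinates of [x]. *)
Lemma projE x : exists2 s, (forall k, k \in s -> base_halfspaces a k) &
  forall y, (forall k, base_halfspaces a k -> k x = k y) -> p y = flips s y.
Proof.
have [s [us sP]] := base_halfspaces_enum.
pose t := [seq k <- s | ~~ k x].
have tP k : k \in t -> base_halfspaces a k.
  by rewrite mem_filter => /andP[_ /sP].
exists t => // y xy; rewrite -(proj_flips _ tP).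
apply: gate_unique (pP _) _; apply: gate_id.
apply: (base_halfspaces_eq (a := a)) => k kP.
rewrite (flips_coord _ tP) ?filter_uniq // mem_filter -(xy k kP) kP.2.
by move/sP: kP => ->; case: (k x).
Qed.

Lemma proj_inj x y : p x = p y ->
  (forall k, base_halfspaces a k -> k x = k y) -> x = y.
Proof.
move=> pxy xy; have [s sP sE] := projE x.
by apply: (flips_inj sP); rewrite -!sE.
Qed.

End Projections.

(** * Compatibility of the projections with the action *)

Section GProjections.
Variables (G : topologicalGroupType) (M : gMedianType G) (a : M).
Hypothesis M_compact : compact [set: M].
Hypothesis finite_base : finite_set (base_halfspaces a).

Variable p : M -> M.
Hypothesis pP : forall x, gate (base_side a) x (p x).

(** [p x] is reached from [x] by flips, and [g] carries an edge crossed by a splitting wall to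
    another such edge, along which [p] is constant. *)
Lemma proj_gact (g : G) x : p (gact g (p x)) = p (gact g x).
Proof.
have [s sP sE] := projE finite_base pP x; rewrite (sE x) // {sE}.
elim: s sP => //= k s IHs sP; rewrite -IHs => [|l ls].
  have /sP[kS _] := mem_head k s.
  apply/esym/(proj_crosses pP (splitting_gact g^-1%g kS)).
  by apply: (crosses_gact _ k _ _).1; rewrite !gactK; exact: flipP.
by apply: sP; rewrite inE ls orbT.
Qed.

Lemma closed_proj_fiber : closed [set x | p x = a].
Proof.
apply: closed_eq_fun; first exact: topmed_hausdorff.
  exact: gate_continuous (@closed_base_side M a) pP.
exact: continuous_const.
Qed.

Lemma convex_proj_fiber : median_convex [set x | p x = a].
Proof.
move=> x y /= px py z xyz; rewrite -xyz /=.
by rewrite (gate_median_map (@convex_base_side M a) pP) px py medxx.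
Qed.

Variable q : M -> M.
Hypothesis qP : forall x, gate [set x | p x = a] x (q x).

(** The fibre contains a point [y] with the same coordinates as [x], and [q x] lies between [x] and
    [y]. *)
Lemma proj_fiber_coord k x : splitting k -> k (q x) = k x.
Proof.
apply: (base_halfspaces_eq (a := a)) => {}k kP.
have [y [py yP]] := proj_surj finite_base pP a (fun l => l x).
have [_ kmed _] := kP.1; have [_ /(_ y) <-] := qP x.
  by rewrite kmed yP // medxx.
by rewrite /= py (proj_base pP).
Qed.

Lemma proj_fiber_eq x y : (forall k, splitting k -> k x = k y) -> q x = q y.
Proof.
move=> xy; apply: (proj_inj finite_base pP) => [|k [kS _]].
  by rewrite (qP x).1 (qP y).1.
by rewrite !proj_fiber_coord ?xy.
Qed.

Lemma proj_fiber_gact (g : G) x : q (gact g (q x)) = q (gact g x).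
Proof.
apply: proj_fiber_eq => k kS.
exact: (proj_fiber_coord x (splitting_gact g kS)).
Qed.

End GProjections.

(** * Retracts *)

(** The image need not be invariant; [retr_gact] is what makes the maps [retr \o gact g] compose to
    an action on it. *)
Record retraction (G : topologicalGroupType) (M : gMedianType G) := Retraction {
  retr :> M -> M;
  retr_continuous : continuous retr;
  retr_med : median_map retr;
  retr_idem : forall x, retr (retr x) = retr x;
  retr_gact : forall g x, retr (gact g (retr x)) = retr (gact g x);
}.

(* The image of a retraction [r], on which [G] acts by [r \o gact g]. *)
Definition retract (G : topologicalGroupType) (M : gMedianType G)
  (r : retraction M) : Type := set_type [set x | r x = x].

Section Retract.
Variables (G : topologicalGroupType) (M : gMedianType G) (r : retraction M).
Local Notation K := (retract r).
Implicit Types (x y z u v : K) (g h : G).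

HB.instance Definition _ := Topological.copy K (set_type [set x | r x = x]).

Definition rval (x : K) : M := set_val x.

Definition corestr (x : M) : K := exist _ (r x) (mem_set (retr_idem r x)).

Lemma rval_inj : injective rval.
Proof. exact: val_inj. Qed.

Lemma corestrK (x : M) : rval (corestr x) = r x.
Proof. by []. Qed.

Lemma retr_rval x : r (rval x) = rval x.
Proof. by case: x => x xP; exact: set_mem xP. Qed.

Lemma rvalK : cancel rval corestr.
Proof. by move=> x; apply: rval_inj; rewrite corestrK retr_rval. Qed.

Lemma rval_continuous : continuous rval.
Proof. exact: initial_continuous. Qed.

Lemma continuous_retract (S : topologicalType) (f : S -> K) :
  continuous (rval \o f) -> continuous f.
Proof. exact: continuous_comp_initial. Qed.

Lemma corestr_continuous : continuous corestr.
Proof. exact/continuous_retract/retr_continuous. Qed.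

Let rmed x y z := corestr (med (rval x) (rval y) (rval z)).

Let rval_rmed x y z : rval (rmed x y z) = med (rval x) (rval y) (rval z).
Proof. by rewrite corestrK retr_med !retr_rval. Qed.

Let rmedCr x y z : rmed x y z = rmed x z y.
Proof. by rewrite /rmed medCr. Qed.

Let rmedCl x y z : rmed x y z = rmed y x z.
Proof. by rewrite /rmed medCl. Qed.

Let rmedxx x y : rmed x x y = x.
Proof. by rewrite /rmed medxx rvalK. Qed.

Let rmed_distr x y z u v :
  rmed (rmed x y z) u v = rmed x (rmed y u v) (rmed z u v).
Proof. by apply: rval_inj; rewrite !rval_rmed med_distr. Qed.

HB.instance Definition _ := isMedianAlgebra.Build K
  rmedCr rmedCl rmedxx rmed_distr.

Lemma rval_med : median_map rval.
Proof. exact: rval_rmed. Qed.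

Let retract_hausdorff : hausdorff_space K.
Proof.
move=> x y clxy; apply/rval_inj/topmed_hausdorff => A B Ax By.
have [z [Az Bz]] := clxy _ _ (rval_continuous Ax) (rval_continuous By).
by exists (rval z).
Qed.

Let retract_med_continuous :
  continuous (fun p : K * K * K => med p.1.1 p.1.2 p.2).
Proof.
apply: (@continuous_compose _ M K (fun p : K * K * K =>
  med (rval p.1.1) (rval p.1.2) (rval p.2)) corestr); last first.
  exact: corestr_continuous.
apply: continuous_med; apply: continuous_compose (rval_continuous).
- exact: continuous_compose (@continuous_fst _ _) (@continuous_fst _ _).
- exact: continuous_compose (@continuous_fst _ _) (@continuous_snd _ _).
- exact: continuous_snd.
Qed.

HB.instance Definition _ := isTopologicalMedian.Build K
  retract_hausdorff retract_med_continuous.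

Let ract g x := corestr (gact g (rval x)).

Let ract1 x : ract 1%g x = x.
Proof. by rewrite /ract gact1 rvalK. Qed.

Let corestr_gact g (x : M) : corestr (gact g x) = ract g (corestr x).
Proof. by apply: rval_inj; rewrite !corestrK retr_gact. Qed.

Let ractM g h x : ract (g * h)%g x = ract g (ract h x).
Proof. by rewrite [LHS]/ract gactM corestr_gact. Qed.

Let corestr_med : median_map corestr.
Proof. by move=> x y z; apply: rval_inj; rewrite rval_med !corestrK retr_med. Qed.

Let ract_med g x y z : ract g (med x y z) = med (ract g x) (ract g y) (ract g z).
Proof. by rewrite /ract rval_med gact_med corestr_med. Qed.

Let ract_continuous : continuous (fun p : G * K => ract p.1 p.2).
Proof.
apply: (@continuous_compose _ M K (fun p : G * K => gact p.1 (rval p.2)) corestr);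
  last exact: corestr_continuous.
apply: (@continuous_compose _ (G * M)%type M (fun p : G * K => (p.1, rval p.2))
  (fun p => gact p.1 p.2)); last exact: gact_continuous.
apply: continuous_pair; first exact: continuous_fst.
exact: continuous_compose (@continuous_snd _ _) rval_continuous.
Qed.

HB.instance Definition _ := isGMedian.Build G K
  ract1 ractM ract_med ract_continuous.

Lemma gact_retract g x : gact g x = corestr (gact g (rval x)).
Proof. by []. Qed.

Lemma corestr_morphism : g_morphism corestr.
Proof.
split; [exact: corestr_continuous|exact: corestr_med|exact: corestr_gact].
Qed.

End Retract.

Section RetractionOfGate.
Variables (G : topologicalGroupType) (M : gMedianType G) (K : set M).
Hypotheses (M_compact : compact [set: M]) (clK : closed K) (cK : median_convex K).
Variables (p : M -> M) (pP : forall x, gate K x (p x)).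
Hypothesis p_gact : forall g x, p (gact g (p x)) = p (gact g x).

Definition gate_retraction : retraction M.
Proof.
apply: (@Retraction G M p) => //.
- exact: gate_continuous clK pP.
- exact: gate_median_map cK pP.
- by move=> x; apply: gate_unique (pP _) _; apply: gate_id; exact: (pP x).1.
Defined.

End RetractionOfGate.

(** * Assembling the decomposition *)

Lemma inj_surj_bijective (S T : Type) (f : S -> T) :
  injective f -> (forall y, exists x, f x = y) -> bijective f.
Proof.
move=> f_inj /choice[h hP]; exists h => // x.
exact/f_inj/hP.
Qed.

Lemma compact_isomorphism (G : topologicalGroupType) (M N : gMedianType G)
    (f : M -> N) :
  compact [set: M] -> g_morphism f -> bijective f -> g_isomorphism f.
Proof.
move=> cM fM f_bij; have [cf fmed fg] := fM; split=> //.
have [h fK hK] := f_bij; exists h; split=> //; split.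
- apply: (closed_graph_continuous (@topmed_hausdorff M) cM).
  rewrite (_ : mkset _ = [set p | p.1 = f p.2]).
    apply: closed_eq_fun; first exact: topmed_hausdorff.
      exact: continuous_fst.
    exact: (continuous_compose (@continuous_snd N M) cf).
  by apply/seteqP; split=> -[x y] /= => [<-|->].
- by move=> x y z; apply: (can_inj fK); rewrite fmed !hK.
- by move=> g x; apply: (can_inj fK); rewrite fg !hK.
Qed.

Theorem propositionA (G : topologicalGroupType) (M : gMedianType G)
    (M_nonempty : [set: M] !=set0) (M_minimal : g_minimal M)
    (M_sclocc : sclocc M)
    (M_intervals : forall x y : M, countable (median_interval x y)) :
  exists (M' C : gMedianType G) (phi : M -> M' * C),
    [/\ g_isomorphism phi,
        is_finite_cube C
      & forall (C' : gMedianType G) (f : M -> C'),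
          is_cube C' -> g_morphism f -> set_surj [set: M] [set: C'] f ->
          exists! h : C -> C',
            g_morphism h /\ forall x : M, f x = h (phi x).2].
Proof.
have [_ _ cM] := M_sclocc.
have [a _] := M_nonempty.
have fin := finite_base_halfspaces a cM M_intervals.
have [p pP] := choice (fun x => gate_exists cM x (@closed_base_side M a)
  (@convex_base_side M a) (ex_intro _ a (fun k _ => erefl))).
have clQ := closed_proj_fiber cM pP.
have cQ := convex_proj_fiber pP.
have [q qP] := choice (fun x => gate_exists cM x clQ cQ
  (ex_intro _ a (proj_base pP))).
pose P := gate_retraction cM (@closed_base_side M a) (@convex_base_side M a) pP
  (proj_gact fin pP).
pose Q := gate_retraction cM clQ cQ qP (proj_fiber_gact fin pP qP).
exists (retract P), (retract Q), (fun x => (corestr P x, corestr Q x)).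
have qk := proj_fiber_coord fin pP qP.
have q_eq x y : (forall k, base_halfspaces a k -> k x = k y) -> q x = q y.
  by move/base_halfspaces_eq => xy; exact: (proj_fiber_eq fin pP qP).
have Q_rval (v : retract Q) : q (rval v) = rval v := retr_rval v.
have P_rval (u : retract P) : p (rval u) = rval u := retr_rval u.
split.
- apply: compact_isomorphism => //.
    have [cP Pmed Pg] := corestr_morphism P.
    have [cQ' Qmed Qg] := corestr_morphism Q.
    split; first exact: continuous_pair.
      by move=> x y z; congr pair; [exact: Pmed|exact: Qmed].
    by move=> g x; congr pair; [exact: Pg|exact: Qg].
  apply: inj_surj_bijective => [x y [pxy qxy]|[u v]].
    apply: (proj_inj fin pP pxy) => k [kS _].
    by rewrite -(qk k x) // -(qk k y) // qxy.
  (* Give [u] the coordinates of [v]: [p] still takes it to [u], and [q], which depends only on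
     coordinates, takes it to [v]. *)
  have [y [py yk]] := proj_surj fin pP (rval u) (fun k => k (rval v)).
  exists y; congr pair; apply: rval_inj.
    by rewrite corestrK /= py P_rval.
  by rewrite corestrK /= -[RHS]Q_rval; exact: q_eq.
- have [s [us sP]] := base_halfspaces_enum fin.
  pose h (i : 'I_(size s)) := nth (fun _ => false) s i.
  have hP i : base_halfspaces a (h i) by apply/sP; exact: mem_nth.
  exists (size s), (fun v i => h i (rval v)); split.
    apply: inj_surj_bijective => [u v uv|e].
      apply: rval_inj; rewrite -Q_rval -[RHS]Q_rval; apply: q_eq => k /sP ks.
      have := congr1 (fun w => w (Ordinal (etrans (index_mem k s) ks))) uv.
      by rewrite /h /= nth_index.
    (* The vertex [e] is read as a function of halfspaces through their index in [s]; the default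
       [false] is used only outside [s]. *)
    have [y [_ yk]] := proj_surj fin pP a
      (fun k => oapp e false (insub (index k s))).
    exists (corestr Q y); apply/funext => i.
    rewrite corestrK /= qk ?yk //; last by have [] := hP i.
    by rewrite index_uniq // valK.
  move=> x y z; apply/funext => i.
  by have [[_ hmed _] _] := hP i; rewrite rval_med hmed.
- move=> C' f [I [phi [phi_bij phi_med]]] fM f_surj.
  (* The coordinates of [f] are splitting walls, which [q] preserves; so [f] factors through its
     restriction to the fibre. *)
  have fq x : f (q x) = f x.
    apply: (bij_inj phi_bij); apply/funext => i.
    exact: (qk _ x (cube_map_splitting M_nonempty M_minimal cM fM f_surj
      phi_bij phi_med i)).
  have [cf fmed fg] := fM.
  exists (f \o @rval _ _ Q); split=> [|h [_ fh]].
    split=> [|x]; last exact/esym/fq.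
    split; first exact: (continuous_compose (@rval_continuous _ _ Q) cf).
      by move=> x y z; rewrite /= rval_med fmed.
    by move=> g x; rewrite /= gact_retract corestrK /= fq fg.
  by apply/funext => v; rewrite /= fh /= rvalK.
Qed.
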